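(* Let $G=(\mathcal X,\mathcal T,g)$ be an $n$-dimensional indefinite metric polyhedron with finite or countable vertex set $\mathcal V$ whose vertex degrees are uniformly bounded, and let $d:=\max\{\deg(v): v\in\mathcal V\}$. (1) Let $\mathcal V'\subset\mathcal V$ and let $\tau':\mathcal V'\to\mathbb R^d_d$ be a partial simplicial isometric map of $G$ into $\mathbb R^d_d$ such that the points $\tau'(v)$, $v\in\mathcal V'$, are in $d$-general position. Then there exists a simplicial isometric map of $G$ into $\mathbb R^d_d$, given by its values on vertices $\tau:\mathcal V\to\mathbb R^d_d$, such that $\tau|_{\mathcal V'}=\tau'$ and the points $\tau(v)$, $v\in\mathcal V$, are also in $d$-general position. (2) If in addition $d\ge 2n+1$, then, for $\tau'$ and $\tau$ as in (1), both $\tau$ and $\tau'$ are automatically injective (as maps extended affinely to the simplices, on $\mathcal X$ and on the subcomplex of all simplices with vertices in $\mathcal V'$ respectively), so $\tau$ is a simplicial isometric embedding.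
   Context: An indefinite metric polyhedron is a triple $(\mathcal X,\mathcal T,g)$, where $(\mathcal X,\mathcal T)$ is a simplicial complex (with $\mathcal X$ the underlying space and $\mathcal T$ the simplicial structure) and $g:E(\mathcal T)\to\mathbb R$ is an arbitrary function on the set $E(\mathcal T)$ of edges ($1$-simplices); $g(e)$ is called the squared length of $e$ and may be any real number, including negative or zero. Such a $g$ is equivalent to a choice of a symmetric bilinear form on every simplex, agreeing on intersections of simplices (not assumed positive-definite or non-degenerate), the value of the form on each edge being its squared length. All indefinite metric polyhedra are assumed finite or countable. The degree $\deg(v)$ of a vertex $v$ is the number of edges containing $v$. The Minkowski space $\mathbb R^d_d$ is the vector space $\mathbb R^{2d}=\{v=(v^+,v^-): v^+,v^-\in\mathbb R^d\}$ with the bilinear form $\langle v,u\rangle_{\mathbb R^d_d}=\langle v^+,u^+\rangle-\langle v^-,u^-\rangle$, where $\langle\cdot,\cdot\rangle$ on the right is the standard scalar product of $\mathbb R^d$. A simplicial map $\mathcal X\to\mathbb R^d_d$ is a map that is affine on every simplex; it is determined by, and identified with, its restriction to the vertices. A simplicial isometric map is a simplicial map $f$ such that the bilinear form of every simplex is the pull-back of $\langle\cdot,\cdot\rangle_{\mathbb R^d_d}$; equivalently, for every edge $e$ with endpoints $a,b$ one has $\langle f(a)-f(b),f(a)-f(b)\rangle_{\mathbb R^d_d}=g(e)$. A simplicial isometric embedding is an injective simplicial isometric map. For $\mathcal V'\subset\mathcal V$, a map $m:\mathcal V'\to\mathbb R^d_d$ is a partial simplicial isometric map if for every edge $e$ with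 both endpoints $a,b\in\mathcal V'$ one has $\langle m(a)-m(b),m(a)-m(b)\rangle_{\mathbb R^d_d}=g(e)$ (equivalently, $m$ preserves the bilinear form of every simplex whose vertices all lie in $\mathcal V'$). A collection (family, indexed by vertices) of points of $\mathbb R^d_d$ is in $d$-general position if every subcollection of at most $d+1$ of its members is affinely independent; thus for vertices this means that the images of any at most $d+1$ distinct vertices are affinely independent. *)

(* Defs.v *)
From mathcomp Require Import all_boot all_order all_algebra.
From mathcomp Require Import finmap.
From mathcomp Require Import all_classical all_reals.
From mathcomp Require Import ring.

Set Implicit Arguments.
Unset Strict Implicit.
Unset Printing Implicit Defensive.

Import Order.TTheory GRing.Theory Num.Theory.

Local Open Scope classical_set_scope.
Local Open Scope card_scope.
Local Open Scope ring_scope.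

(* Every element of V is a vertex, so V is the vertex set. *)
Record simplicialComplex (V : choiceType) := SimplicialComplex {
  simplex : set {fset V};
  simplex_neq0 : forall s, simplex s -> s != fset0%fset;
  simplex_sub : forall s t, simplex s -> (t `<=` s)%fset -> t != fset0%fset -> simplex t;
  simplex_vertex : forall v, simplex [fset v]%fset }.

(* Only the values of [sqlen] on edges are meaningful; no other value is used. *)
Record indefPolyhedron (R : realType) (V : choiceType) := IndefPolyhedron {
  complex :> simplicialComplex V;
  sqlen : {fset V} -> R }.

Section Complex.
Variables (V : choiceType) (K : simplicialComplex V).

Definition edges : set {fset V} := [set e | simplex K e /\ #|` e| = 2%N].

Definition has_degree (v : V) (k : nat) : Prop :=
  [set e | edges e /\ v \in e] #= `I_k.

Definition max_degree (d : nat) : Prop :=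
  (forall v, exists2 k, has_degree v k & (k <= d)%N) /\
  (exists v, has_degree v d).

Definition has_dimension (n : nat) : Prop :=
  (forall s, simplex K s -> (#|` s| <= n.+1)%N) /\
  (exists2 s, simplex K s & #|` s| = n.+1).

End Complex.

Definition minkowski (R : realType) (d : nat) : lmodType R :=
  ('rV[R]_d * 'rV[R]_d)%type.

Definition mform (R : realType) (d : nat) (v u : minkowski R d) : R :=
  \sum_(i < d) v.1 0 i * u.1 0 i - \sum_(i < d) v.2 0 i * u.2 0 i.

Section Maps.
Variables (R : realType) (V : choiceType) (d : nat).
Implicit Types (A : set V) (f : V -> minkowski R d) (s : {fset V}).

Definition affine_independent f s : Prop :=
  forall c : V -> R,
    \sum_(v <- s) c v = 0 -> \sum_(v <- s) c v *: f v = 0 ->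
    forall v, v \in s -> c v = 0.

Definition general_position A f : Prop :=
  forall s, (forall v, v \in s -> A v) -> (#|` s| <= d.+1)%N ->
    affine_independent f s.

(* Points of the underlying space are given by barycentric coordinates; the
   support of x is the simplex whose relative interior contains x. *)
Definition realization (K : simplicialComplex V) A :
    set {fsfun V -> R with 0} :=
  [set x | [/\ simplex K (finsupp x), forall v, v \in finsupp x -> A v,
               forall v, 0 <= x v & \sum_(v <- finsupp x) x v = 1]].

Definition affine_ext f (x : {fsfun V -> R with 0}) : minkowski R d :=
  \sum_(v <- finsupp x) x v *: f v.

Variable G : indefPolyhedron R V.

(* Vectors parallel to the simplex s are written sum_(v in s) c v . v with
   sum_(v in s) c v = 0. This is the bilinear form on them determined by the
   squared lengths of the edges: since sum c = sum c' = 0, for a form B one has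
   B(c, c') = - 1/2 sum_(u, v) c u c' v B(u - v, u - v). *)
Definition simplex_form s (c c' : V -> R) : R :=
  - 2^-1 * \sum_(u <- s) \sum_(v <- s | v != u)
              c u * c' v * sqlen G [fset u; v]%fset.

Definition isometric f : Prop :=
  forall s, simplex G s -> forall c c' : V -> R,
    \sum_(v <- s) c v = 0 -> \sum_(v <- s) c' v = 0 ->
    mform (\sum_(v <- s) c v *: f v) (\sum_(v <- s) c' v *: f v)
      = simplex_form s c c'.

Definition isometric_embedding f : Prop :=
  isometric f /\ set_inj (realization G setT) (affine_ext f).

(* A partial map on A is represented by a total one, of which only the values
   on A matter. *)
Definition partial_isometric A f : Prop :=
  forall a b, a != b -> edges G [fset a; b]%fset -> A a -> A b ->
    mform (f a - f b) (f a - f b) = sqlen G [fset a; b]%fset.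

End Maps.

Section IsometricEdges.
Variables (R : realType) (V : choiceType) (d : nat) (G : indefPolyhedron R V).
Implicit Types (f : V -> minkowski R d) (s : {fset V}).

Lemma mformDl (u v w : minkowski R d) : mform (u + v) w = mform u w + mform v w.
Proof.
rewrite /mform addrACA -opprD -!big_split /=.
by congr (_ - _); apply: eq_bigr => i _; rewrite mxE mulrDl.
Qed.

Lemma mformZl a (u w : minkowski R d) : mform (a *: u) w = a * mform u w.
Proof.
rewrite /mform /= mulrBr !mulr_sumr.
by congr (_ - _); apply: eq_bigr => i _; rewrite mxE mulrA.
Qed.

Lemma mformC (u v : minkowski R d) : mform u v = mform v u.
Proof. by congr (_ - _); apply: eq_bigr => i _; rewrite mulrC. Qed.

Lemma mform0l (w : minkowski R d) : mform 0 w = 0.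
Proof. by rewrite -[0 in LHS](scale0r 0) mformZl mul0r. Qed.

Lemma mform_suml (r : seq V) (c : V -> R) f w :
  mform (\sum_(v <- r) c v *: f v) w = \sum_(v <- r) c v * mform (f v) w.
Proof.
elim/big_rec2: _ => [|v x y _ <-]; first exact: mform0l.
by rewrite mformDl mformZl.
Qed.

Lemma mformBB (u v : minkowski R d) :
  mform (u - v) (u - v) = mform u u + mform v v - 2 * mform u v.
Proof.
rewrite -scaleN1r mformDl mformZl ![mform _ (_ + _)]mformC !mformDl !mformZl.
by rewrite (mformC v u); ring.
Qed.

Lemma sum_edge (M : lmodType R) (h : V -> M) a b : a != b ->
  \sum_(v <- [fset a; b]%fset) ((v == a)%:R - (v == b)%:R) *: h v = h a - h b.
Proof.
move=> ab; rewrite big_fsetU1 ?inE //= big_seq_fset1 !eqxx (negPf ab).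
by rewrite eq_sym (negPf ab) subr0 sub0r scale1r scaleN1r.
Qed.

Lemma simplex_form_edge a b : a != b ->
  let c := fun v => (v == a)%:R - (v == b)%:R in
  simplex_form G [fset a; b]%fset c c = sqlen G [fset a; b]%fset.
Proof.
move=> ab c; have ba : b != a by rewrite eq_sym.
have cE : (c a = 1) * (c b = -1).
  by rewrite /c !eqxx (negPf ab) (negPf ba) subr0 sub0r.
rewrite /simplex_form big_fsetU1 ?inE //= big_seq_fset1.
rewrite !(big_mkcond (fun v => v != _)) !big_fsetU1 ?inE //= !big_seq_fset1.
rewrite !eqxx ab ba /= !cE [[fset b; a]%fset]fsetUC.
by field.
Qed.

Lemma isometricP f : isometric G f <-> partial_isometric G setT f.
Proof.
split=> [fG a b ab [Gab _] _ _|fG s Gs c c' c0 c'0].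
  have s0 : \sum_(v <- [fset a; b]%fset) ((v == a)%:R - (v == b)%:R) = 0 :> R.
    rewrite -[RHS](subrr (1 : R)) -(sum_edge (M := R^o) (fun=> 1) ab).
    by apply: eq_bigr => v _; rewrite /GRing.scale /= mulr1.
  have := fG _ Gab _ _ s0 s0.
  by rewrite sum_edge // simplex_form_edge.
rewrite mform_suml /simplex_form mulr_sumr.
pose q v := mform (f v) (f v).
transitivity (\sum_(u <- s) \sum_(v <- s)
   (2^-1 * (c u * q u * c' v + c' v * q v * c u)
     - 2^-1 * (c u * c' v * mform (f u - f v) (f u - f v)))).
  apply: eq_bigr => u _; rewrite mformC mform_suml mulr_sumr.
  apply: eq_bigr => v _; rewrite mformBB (mformC (f v)) /q.
  by field.
transitivity (\sum_(u <- s) (2^-1 * (\sum_(v <- s) c' v * q v) * c u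
    - 2^-1 * \sum_(v <- s | v != u) c u * c' v * sqlen G [fset u; v]%fset)).
  apply: eq_big_seq => u us; rewrite sumrB; congr (_ - _).
    rewrite -mulr_sumr big_split /= -mulr_sumr c'0 mulr0 add0r -mulr_suml.
    by rewrite mulrA.
  rewrite -mulr_sumr; congr (_ * _); rewrite [RHS]big_mkcond.
  apply: eq_big_seq => v vs; case: eqVneq => [->|vu] /=.
    by rewrite subrr mform0l mulr0.
  rewrite fG 1?eq_sym //; split; last by rewrite cardfs2 eq_sym vu.
  apply: simplex_sub Gs _ _; last by apply/fset0Pn; exists u; rewrite !inE eqxx.
  by apply/fsubsetP => w; rewrite !inE => /orP[]/eqP->.
rewrite sumrB -[X in X - _]mulr_sumr c0 mulr0 sub0r -sumrN.
by apply: eq_bigr => u _; rewrite mulNr.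
Qed.

End IsometricEdges.

(* Main.v *)
Require Import Defs.
From mathcomp Require Import all_boot all_order all_algebra.
From mathcomp Require Import finmap.
From mathcomp Require Import all_classical all_reals.
From mathcomp Require Import ring zify.
From mathcomp Require measure lebesgue_measure.

Set Implicit Arguments.
Unset Strict Implicit.
Unset Printing Implicit Defensive.

Import Order.TTheory GRing.Theory Num.Theory.

Local Open Scope classical_set_scope.
Local Open Scope card_scope.
Local Open Scope ring_scope.

(** The vertices outside V' are placed one at a time, in the order of an
    enumeration of V, each choice keeping all edges between placed vertices at
    their prescribed squared lengths and all placed points in d-general position.

    When v is placed, it has k <= d placed neighbours, at affinely independent
    points p_0, ..., p_(k-1).  Writing x = p_0 + y and D_j = p_j - p_0, the k
    conditions on x become k - 1 linear equations (y, D_j) = h_j and a single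
    quadratic one (y, y) = g.  The D_j are linearly independent and the form is
    nondegenerate, so the linear equations cut out an affine space W of dimension
    2d - k + 1 >= d + 1.  As there are fewer than d vectors D_j, both the
    positive and the negative copy of R^d contain a unit vector orthogonal to
    all of them; the sum f of these two unit vectors is isotropic, parallel to W,
    and not orthogonal to W.  Along a line y + R f the quadratic condition is
    therefore of degree one, and has exactly one solution as soon as (y, f) <> 0
    ([mform_isotropic_line]).  So W, generically, can be slid along f into the
    quadric.  (For k = 0 there is no condition, and any quadric will do.)

    The new point must avoid the affine span of every set of at most d placed
    points.  Such a span, thickened by the direction f, has dimension at most d,
    hence does not contain W; it therefore suffices that the starting point of
    the slide avoids countably many proper affine subspaces of W
    ([submx_avoid], [generic_quadric_point]).

    Both properties that are maintained concern finitely many vertices at a time,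
    so they pass to the limit of the countable construction ([extend_isometric]).

    For injectivity, two points of the realization with the same image have
    supports with at most 2(n + 1) <= d + 1 vertices in total; these vertices
    have affinely independent images, so the barycentric coordinates of the two
    points agree ([realization_inj]). *)

(** * Avoiding countably many subspaces *)

(** The real line is uncountable: a countable set has Lebesgue measure zero. *)
Lemma countable_neq_setT (R : realType) (A : set R) :
  countable A -> exists t, ~ A t.
Proof.
move=> /lebesgue_measure.countable_lebesgue_measure0 A0.
apply/not_existsP => hA; move: A0.
have -> : A = `]-oo, +oo[%classic.
  by apply/seteqP; split=> [//|t _]; exact: contrapT (hA t).
by rewrite lebesgue_measure.lebesgue_measure_itv.
Qed.

Lemma countable_roots (R : realType) (p : {poly R}) :
  p != 0 -> countable [set t | root p t].
Proof.
move=> p0; apply: finite_set_countable; apply: contrapT => infp.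
have [X Xp cX] := infinite_set_fset (size p) infp.
have Xroots : all (root p) X by apply/allP => t tX; exact: Xp.
by have := max_poly_roots p0 Xroots (fset_uniq X); rewrite ltnNge cX.
Qed.

(** A vector space over an uncountable field is not a countable union of proper
    subspaces.  The combinations of the rows of E with coefficients
    1, t, t^2, ... run along a moment curve, and a subspace that does not contain
    all of E meets this curve only at the roots of a nonzero polynomial in t. *)
Lemma submx_avoid (R : realType) (T : countType) (P : T -> Prop)
    (m n : nat) (k : T -> nat)
    (E : 'M[R]_(m, n)) (M : forall i, 'M[R]_(k i, n)) :
  (forall i, P i -> ~~ (E <= M i)%MS) ->
  exists2 v : 'rV[R]_n, (v <= E)%MS & forall i, P i -> ~~ (v <= M i)%MS.
Proof.
move=> EM; pose v t : 'rV[R]_n := (\row_(j < m) t ^+ j) *m E.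
suff [t ht] : exists t,
    ~ (\bigcup_(i in [set i | P i]) [set t | (v t <= M i)%MS]) t.
  exists (v t); first exact: submxMl.
  by move=> i Pi; apply/negP => vM; apply: ht; exists i.
apply: countable_neq_setT; apply: bigcup_countable => // i Pi.
have /matrix0Pn[a [j cj]] : E *m cokermx (M i) != 0.
  by rewrite -submxE; exact: EM.
pose p := rVpoly (col j (E *m cokermx (M i)))^T.
have pE t : p.[t] = (v t *m cokermx (M i)) 0 j.
  rewrite horner_poly -mulmxA mxE; apply: eq_bigr => b _.
  by rewrite valK !mxE mulrC.
have p0 : p != 0.
  apply: contraNneq cj => p0.
  have := coef_rVpoly_ord (col j (E *m cokermx (M i)))^T a.
  by rewrite -/p p0 coef0 !mxE => <-.
apply: sub_countable (countable_roots p0); apply: subset_card_le => t /=.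
by rewrite submxE => /eqP vM; rewrite rootE pE vM mxE.
Qed.

(** * Generic points at prescribed squared distances *)

Section Homogeneous.
Variables (R : realType) (d : nat).
Implicit Types (a b : R) (x y u : minkowski R d).

(** The homogeneous coordinates (a, x) in R x R^(2d).  Affine conditions on x
    become linear conditions on [homog 1 x], so that the rank theory of matrices
    applies to affine spans as well. *)
Definition homog a x : 'rV[R]_(1 + (d + d)) := row_mx a%:M (row_mx x.1 x.2).

(** The column of the linear form (a, x) |-> a b + (x, u). *)
Definition cohomog b u : 'cV[R]_(1 + (d + d)) :=
  (row_mx b%:M (row_mx u.1 (- u.2)))^T.

Lemma homog_mul_cohomog a x b u :
  homog a x *m cohomog b u = (a * b + mform x u)%:M.
Proof.
rewrite /homog /cohomog !tr_row_mx !mul_row_col tr_scalar_mx -scalar_mxM.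
apply/matrixP => i j.
rewrite !ord1 !mxE eqxx !mulr1n /mform; congr (_ + (_ + _)).
  by apply: eq_bigr => l _; rewrite mxE.
by rewrite -sumrN; apply: eq_bigr => l _; rewrite !mxE mulrN.
Qed.

Lemma homogZ c a x : homog (c * a) (c *: x) = c *: homog a x.
Proof. by rewrite /homog !scale_row_mx scale_scalar_mx. Qed.

Lemma homogD a x b y : homog (a + b) (x + y) = homog a x + homog b y.
Proof. by rewrite /homog !add_row_mx raddfD. Qed.

Lemma homog_sum (I : Type) (s : seq I) (c : I -> R) (p : I -> minkowski R d) :
  homog (\sum_(i <- s) c i) (\sum_(i <- s) c i *: p i)
    = \sum_(i <- s) c i *: homog 1 (p i).
Proof.
elim/big_rec3: _ => [|i z x a _ <-]; last by rewrite -homogZ -homogD mulr1.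
by rewrite /homog !row_mx0 raddf0 row_mx0.
Qed.

Lemma homogP (v : 'rV[R]_(1 + (d + d))) : exists a x, v = homog a x.
Proof.
exists (lsubmx v 0 0), (lsubmx (rsubmx v), rsubmx (rsubmx v)).
by rewrite /homog -mx11_scalar !hsubmxK.
Qed.

Definition constraints r (D : 'I_r -> minkowski R d) (h : 'I_r -> R) :
  'M[R]_(1 + (d + d), r) := \matrix_(i, j) cohomog (- h j) (D j) i 0.

Lemma sub_ker_constraints r (D : 'I_r -> minkowski R d) h a x :
  reflect (forall j, mform x (D j) = a * h j)
          (homog a x <= kermx (constraints D h))%MS.
Proof.
have E j : (homog a x *m constraints D h) 0 j = mform x (D j) - a * h j.
  have := congr1 (fun A : 'M_1 => A 0 0) (homog_mul_cohomog a x (- h j) (D j)).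
  rewrite !mxE eqxx mulr1n mulrN addrC => <-.
  by apply: eq_bigr => i _; rewrite !mxE.
apply: (iffP (sub_kermxP)) => [H j|H].
  by apply/eqP; rewrite -subr_eq0 -E H mxE.
by apply/rowP => j; rewrite E H subrr mxE.
Qed.

(** The Minkowski form is nondegenerate: a linear dependence between the forms
    (_, D_j) would be one between the D_j. *)
Lemma mform_solve r (D : 'I_r -> minkowski R d) (h : 'I_r -> R) :
  (forall c : 'I_r -> R, \sum_j c j *: D j = 0 -> forall j, c j = 0) ->
  exists y, forall j, mform y (D j) = h j.
Proof.
move=> Dfree; pose flat (u : minkowski R d) := row_mx u.1 (- u.2).
pose N := \matrix_j flat (D j).
have NE (c : 'rV_r) : c *m N = flat (\sum_j c 0 j *: D j).
  rewrite mulmx_sum_row; under eq_bigr do rewrite rowK.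
  elim/big_rec2: _ => [|j x _ _ ->]; first by rewrite /flat oppr0 row_mx0.
  by rewrite /flat scale_row_mx add_row_mx opprD -scalerN.
have /row_freeP[B NB] : row_free N.
  apply: inj_row_free => c; rewrite NE -row_mx0 => /eq_row_mx[s1 /eqP].
  rewrite oppr_eq0 => /eqP s2; apply/rowP => j; rewrite mxE.
  by apply: (Dfree (c 0)); apply: injective_projections.
pose z := (\row_j h j) *m B^T.
exists (lsubmx z, rsubmx z) => j.
have <- : (z *m N^T) 0 j = h j by rewrite -mulmxA -trmx_mul NB trmx1 mulmx1 mxE.
rewrite -[in RHS](hsubmxK z) mxE big_split_ord /= /mform -sumrN.
by congr (_ + _); apply: eq_bigr => i _;
  rewrite !mxE ?(unsplitK (inl _)) ?(unsplitK (inr _)) ?mxE ?mulrN.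
Qed.

Lemma unit_orthogonal r (D : 'I_r -> 'rV[R]_d) : (r < d)%N ->
  exists u : 'rV[R]_d, \sum_i u 0 i * u 0 i = 1 /\
    forall j, \sum_i u 0 i * D j 0 i = 0.
Proof.
move=> rd; pose C : 'M[R]_(d, r) := \matrix_(i, j) D j 0 i.
have /rowV0Pn[u /sub_kermxP uC u0] : kermx C != 0.
  rewrite -mxrank_eq0 mxrank_ker subn_eq0 -ltnNge.
  exact: leq_ltn_trans (rank_leq_col C) rd.
pose q := \sum_i u 0 i * u 0 i.
have q0 : 0 < q.
  have /rV0Pn[i ui] := u0.
  rewrite /q (bigD1 i) //= ltr_wpDr ?sumr_ge0 // => [k _|];
    rewrite -expr2 ?sqr_ge0 //.
  by rewrite exprn_even_gt0.
exists ((Num.sqrt q)^-1 *: u); split=> [|j].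
  under eq_bigr do rewrite !mxE mulrACA.
  by rewrite -mulr_sumr -invfM -expr2 sqr_sqrtr ?mulVf ?gt_eqF ?ltW.
under eq_bigr do rewrite !mxE -mulrA.
rewrite -mulr_sumr; have := congr1 (fun A : 'rV_r => A 0 j) uC.
by rewrite !mxE; under eq_bigr do rewrite mxE; move=> ->; rewrite mulr0.
Qed.

(** With u and w unit vectors of R^d orthogonal to the positive and to the
    negative parts of the D_j, take e = (u, 0) and f = (u, w).  The vector e
    witnesses that f is not in the radical of the orthogonal of the D_j, although
    the form may be very degenerate on that space. *)
Lemma isotropic_orthogonal r (D : 'I_r -> minkowski R d) : (r < d)%N ->
  exists e f : minkowski R d,
    [/\ forall j, mform e (D j) = 0, forall j, mform f (D j) = 0,
      mform f f = 0 & mform e f = 1].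
Proof.
move=> rd; have [u [uu uD]] := unit_orthogonal (fun j => (D j).1) rd.
have [w [ww wD]] := unit_orthogonal (fun j => (D j).2) rd.
have sum0 (x : 'rV[R]_d) : \sum_i (0 : 'rV[R]_d) 0 i * x 0 i = 0.
  by rewrite big1 // => i _; rewrite mxE mul0r.
exists (u, 0), (u, w); split=> [j|j||]; rewrite /mform /=.
- by rewrite uD sum0 subrr.
- by rewrite uD wD subrr.
- by rewrite uu ww subrr.
- by rewrite uu sum0 subr0.
Qed.

(** Along an isotropic direction a quadric is given by an equation of degree one,
    so it can be reached without solving a quadratic equation. *)
Lemma mform_isotropic_line y f b : mform f f = 0 ->
  mform (y + b *: f) (y + b *: f) = mform y y + 2 * b * mform y f.
Proof.
move=> ff; rewrite -[b *: f]opprK -scaleNr mformBB mformZl !(mformC _ (_ *: f)).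
by rewrite !mformZl ff (mformC f); ring.
Qed.

(** The point is found by sliding a generic solution of the linear equations
    along the isotropic direction f of [isotropic_orthogonal].  The solution is
    chosen outside each subspace M_i extended by f, so no slide leads into M_i,
    and outside the orthogonal of f, so the slide reaches the quadric.  In
    homogeneous coordinates the space E of solutions has rank at least d + 2,
    while M_i extended by f has rank at most d + 1. *)
Lemma generic_quadric_point r (D : 'I_r -> minkowski R d) (h : 'I_r -> R)
    (g : R) (T : countType) (P : T -> Prop) (k : T -> nat)
    (M : forall i, 'M[R]_(k i, 1 + (d + d))) :
  (r < d)%N ->
  (forall c : 'I_r -> R, \sum_j c j *: D j = 0 -> forall j, c j = 0) ->
  (forall i, P i -> (\rank (M i) <= d)%N) ->
  exists y, [/\ mform y y = g, forall j, mform y (D j) = h j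
    & forall i, P i -> ~~ (homog 1 y <= M i)%MS].
Proof.
move=> rd Dfree Mrank.
have [y0 y0D] := mform_solve h Dfree.
have [e [f [eD fD ff ef]]] := isotropic_orthogonal D rd.
pose E := kermx (constraints D h).
have rankE : (d.+2 <= \rank E)%N.
  by rewrite mxrank_ker; have := rank_leq_col (constraints D h); lia.
(* [None] is the hyperplane at infinity, whose avoidance allows to normalize the
   vector found to [homog 1 y]; [Some None] is the orthogonal of f. *)
pose k' (i : option (option T)) : nat :=
  if i is Some (Some i) then (k i + 1)%N else (1 + (d + d))%N.
pose M' i : 'M[R]_(k' i, 1 + (d + d)) :=
  match i with
  | None => kermx (cohomog 1 0)
  | Some None => kermx (cohomog 0 f)
  | Some (Some i) => col_mx (M i) (homog 0 f)
  end.
pose P' (i : option (option T)) := if i is Some (Some i) then P i else True.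
have sub_ker_cohomog a x b u :
    (homog a x <= kermx (cohomog b u))%MS = (a * b + mform x u == 0).
  rewrite (sameP sub_kermxP eqP) homog_mul_cohomog.
  apply/eqP/eqP => [/(congr1 (fun A : 'M_1 => A 0 0))|->].
    by rewrite !mxE.
  by rewrite raddf0.
have EM i : P' i -> ~~ (E <= M' i)%MS.
  case: i => [[i|]|] /= Pi.
  - apply/negP => /mxrankS; apply/negP; rewrite -ltnNge.
    apply: leq_trans rankE; rewrite ltnS -addsmxE.
    rewrite (leq_trans (mxrank_adds_leqif _ _)) // -[X in (_ <= X)%N]addn1.
    by rewrite leq_add ?Mrank ?rank_leq_row.
  - apply/negP => EM; have : (homog 0 e <= E)%MS.
      by apply/sub_ker_constraints => j; rewrite mul0r.
    move=> /submx_trans/(_ EM); rewrite sub_ker_cohomog mul0r add0r ef.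
    by rewrite oner_eq0.
  - apply/negP => EM; have : (homog 1 y0 <= E)%MS.
      by apply/sub_ker_constraints => j; rewrite mul1r.
    move=> /submx_trans/(_ EM); rewrite sub_ker_cohomog mformC mform0l.
    by rewrite mul1r addr0 oner_eq0.
have [v vE vM] := submx_avoid EM.
have [a [x vax]] := homogP v.
have a0 : a != 0.
  by have := vM None I; rewrite vax sub_ker_cohomog mformC mform0l mulr1 addr0.
have xf : mform x f != 0.
  by have := vM (Some None) I; rewrite vax sub_ker_cohomog mulr0 add0r.
have [y [vay yE yf]] : exists y, [/\ v = a *: homog 1 y,
    (homog 1 y <= E)%MS & mform y f != 0].
  have vay : v = a *: homog 1 (a^-1 *: x) by rewrite -homogZ mulr1 scalerKV.
  exists (a^-1 *: x); split=> //; last by rewrite mformZl mulf_neq0 ?invr_eq0.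
  by rewrite -(scalerK a0 (homog _ _)) -vay scalemx_sub.
pose b := (g - mform y y) / (2 * mform y f).
exists (y + b *: f); split.
- by rewrite mform_isotropic_line // /b; field.
- move=> j; rewrite mformDl mformZl fD mulr0 addr0.
  by have /sub_ker_constraints/(_ j) := yE; rewrite mul1r.
- move=> i Pi; have := vM (Some (Some i)) Pi; apply: contra => yM /=.
  rewrite -addsmxE vay scalemx_sub //.
  have -> : homog 1 y = homog 1 (y + b *: f) + - b *: homog 0 f.
    by rewrite -homogZ -homogD mulr0 addr0 scaleNr addrK.
  by rewrite addmx_sub_adds // scalemx_sub.
Qed.

End Homogeneous.

Section Spheres.
Variables (R : realType) (d : nat) (V : countType) (tau : V -> minkowski R d).

(** Subtracting p0 puts the base point at the origin; it preserves affine
    combinations, so the spans to be avoided may be translated along. *)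
Lemma generic_translated_point r (D : 'I_r -> minkowski R d) (h : 'I_r -> R)
    (g : R) (p0 : minkowski R d) :
  (r < d)%N ->
  (forall c : 'I_r -> R, \sum_j c j *: D j = 0 -> forall j, c j = 0) ->
  exists x, [/\ mform (x - p0) (x - p0) = g,
    forall j, mform (x - p0) (D j) = h j &
    forall (s : {fset V}) (c : V -> R), (#|` s| <= d)%N ->
      \sum_(v <- s) c v = 1 -> x != \sum_(v <- s) c v *: tau v].
Proof.
move=> rd Dfree.
pose q v := homog 1 (tau v - p0).
pose M (s : {fset V}) := (\sum_(v : s) <<q (val v)>>)%MS.
have [|y [yg yD yM]] := @generic_quadric_point R d r D h g {fset V}
    (fun s => #|` s| <= d)%N _ M rd Dfree.
  move=> s; apply: leq_trans; apply: leq_trans (mxrank_sum_leqif _) _ => /=.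
  rewrite cardfE -sum1_card; apply: leq_sum => v _.
  by rewrite genmxE rank_leq_row.
exists (y + p0); rewrite addrK; split=> // s c sd c1; apply/eqP => xE.
have yE : y = \sum_(v <- s) c v *: (tau v - p0).
  under eq_bigr do rewrite scalerBr.
  by rewrite sumrB -xE -scaler_suml c1 scale1r addrK.
have /negP := yM s sd; apply; rewrite yE -c1 homog_sum big_seq_fsetE /=.
apply: summx_sub => v _; apply: scalemx_sub.
by apply: (sumsmx_sup v) => //; rewrite genmxE.
Qed.

(** Subtracting the equation at p_0 from the one at p_j leaves a linear equation
    in x - p_0, by polarization: the right-hand sides h_j below. *)
Lemma generic_point_at_distances k (p : 'I_k -> minkowski R d)
    (rho : 'I_k -> R) :
  (0 < d)%N -> (k <= d)%N ->
  (forall c : 'I_k -> R, \sum_i c i = 0 -> \sum_i c i *: p i = 0 ->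
     forall i, c i = 0) ->
  exists x, (forall i, mform (x - p i) (x - p i) = rho i) /\
    forall (s : {fset V}) (c : V -> R), (#|` s| <= d)%N ->
      \sum_(v <- s) c v = 1 -> x != \sum_(v <- s) c v *: tau v.
Proof.
move=> d0; case: k => [|k] in p rho * => kd pfree.
  (* With no condition, the quadric may be chosen at will: here (x, x) = 0. *)
  have [|x [_ _ xs]] := @generic_translated_point 0 (fun=> 0) (fun=> 0) 0 0 d0.
    by move=> c _ [].
  by exists x; split=> // -[].
pose D j := p (lift ord0 j) - p ord0.
pose h j := 2^-1 * (rho ord0 + mform (D j) (D j) - rho (lift ord0 j)).
have [|x [x0 xD xs]] :=
    generic_translated_point (D := D) h (rho ord0) (p ord0) kd.
  move=> c cD j.
  pose c' (i : 'I_k.+1) := if unlift ord0 i is Some j then c j else - \sum_j c j.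
  have c'0 : c' ord0 = - \sum_j c j by rewrite /c' unlift_none.
  have c'S i : c' (lift ord0 i) = c i by rewrite /c' liftK.
  rewrite -c'S; apply: pfree.
    by rewrite big_ord_recl (eq_bigr _ (fun i _ => c'S i)) c'0 addNr.
  rewrite big_ord_recl; under eq_bigr do rewrite c'S.
  rewrite -[RHS]cD /D; under [in RHS]eq_bigr do rewrite scalerBr.
  by rewrite sumrB -scaler_suml c'0 scaleNr addrC.
exists x; split=> // i; case: (unliftP ord0 i) => [j|] -> //.
have -> : x - p (lift ord0 j) = (x - p ord0) - D j.
  by rewrite /D opprB addrA subrK.
by rewrite mformBB xD x0 /h; field.
Qed.

End Spheres.

(** * Placing the vertices one at a time *)

Section Extension.
Variables (R : realType) (V : countType) (d : nat) (G : indefPolyhedron R V).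
Implicit Types (A : set V) (t : V -> minkowski R d) (v w : V).

Lemma eq_affine_independent t t' (s : {fset V}) :
  {in s, t =1 t'} -> affine_independent t s -> affine_independent t' s.
Proof.
move=> tt' ts c c0 ct'; apply: ts => //; rewrite -[RHS]ct'.
by apply: eq_big_seq => v vs; rewrite tt'.
Qed.

(** The edges at v are in bijection with the neighbours of v. *)
Lemma finite_neighbours A v k : has_degree G v k ->
  exists2 N : {fset V}, (#|` N| <= k)%N &
    forall w, w \in N <-> [/\ A w, w != v & edges G [fset v; w]%fset].
Proof.
move=> vk; pose S := [set w | [/\ A w, w != v & edges G [fset v; w]%fset]].
have Sk : S #<= `I_k.
  have -> : (S #<= `I_k) = ((fun w => [fset v; w]%fset) @` S #<= `I_k).
    apply: card_le_eql; rewrite card_eq_sym.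
    apply: inj_card_eq => w w' /set_mem[_ wv _] _ E.
    have : w \in [fset v; w']%fset by rewrite -E !inE eqxx orbT.
    by rewrite !inE (negPf wv) => /eqP.
  rewrite -(card_le_eqr vk); apply: subset_card_le => _ [w [_ _ vw] <-].
  by split=> //; rewrite !inE eqxx.
have [m Sm] : exists m, S #= `I_m.
  by apply/finite_setP; exact: card_le_finite Sk (finite_II k).
exists (fset_set S) => [|w].
  by rewrite (card_fset_set Sm) -card_le_II -(card_le_eql Sm).
rewrite in_fset_set; first by split=> [/set_mem|/mem_set].
by apply/finite_setP; exists m.
Qed.

Definition extend t v x : V -> minkowski R d :=
  fun w => if w == v then x else t w.

Lemma affine_independent_nth t (s : {fset V}) : affine_independent t s ->
  forall c : 'I_(size s) -> R, \sum_i c i = 0 ->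
    \sum_i c i *: t (tnth (in_tuple s) i) = 0 -> forall i, c i = 0.
Proof.
move=> ts c c0 ct; pose c' w := oapp c 0 (insub (index w s)).
have c'E i : c' (tnth (in_tuple s) i) = c i.
  by rewrite /c' (tnth_nth (tnth (in_tuple s) i)) index_uniq //= ?fset_uniq ?valK.
move=> i; rewrite -c'E; apply: ts; last exact: mem_tnth.
  by rewrite big_tnth; under eq_bigr do rewrite c'E.
by rewrite big_tnth; under eq_bigr do rewrite c'E.
Qed.

(** A nontrivial affine dependence that involves v would express the new point x
    as an affine combination of at most d of the other points. *)
Lemma extend_general_position A t v x : general_position A t ->
  (forall (s : {fset V}) (c : V -> R), (#|` s| <= d)%N ->
      \sum_(w <- s) c w = 1 -> x != \sum_(w <- s) c w *: t w) ->
  general_position (A `|` [set v]) (extend t v x).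
Proof.
move=> At xt s sA sd; have [vs|vs] := boolP (v \in s); last first.
  apply: (@eq_affine_independent t) => [w ws|].
    by rewrite /extend; case: (eqVneq w v) ws vs => // -> ->.
  apply: At => // w ws; case: (sA w ws) => //= wv.
  by rewrite -wv ws in vs.
pose s' := (s `\ v)%fset.
have s'd : (#|` s'| <= d)%N by move: sd; rewrite (cardfsD1 v) vs.
have s'v w : w \in s' -> w == v = false by rewrite !inE => /andP[/negPf].
move=> c; rewrite !(big_fsetD1 v vs) /= -/s' {1}/extend eqxx => c0 cx0.
have cxE : c v *: x + \sum_(w <- s') c w *: t w = 0.
  rewrite -[RHS]cx0; congr (_ + _); apply: eq_big_seq => w /s'v wv.
  by rewrite /extend wv.
have cv : c v = 0.
  apply/eqP; apply: contraT => cv.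
  have c1 : \sum_(w <- s') - (c v)^-1 * c w = 1.
    rewrite -mulr_sumr -[\sum_(w <- s') _](addKr (c v)) c0 addr0.
    by rewrite mulrNN mulVf.
  have := xt _ _ s'd c1; apply: contraNT => _; apply/eqP.
  under eq_bigr do rewrite -scalerA.
  rewrite -scaler_sumr -[\sum_(w <- s') _](addKr (c v *: x)) cxE addr0.
  by rewrite scaleNr scalerN opprK scalerK.
have s'A w : w \in s' -> A w.
  by rewrite !inE => /andP[/eqP wv /sA[]].
move=> w ws; case: (eqVneq w v) => [->//|wv].
apply: (At s' s'A (leq_trans s'd _)) => //.
- by rewrite -[RHS]c0 cv add0r.
- by rewrite -[RHS]cxE cv scale0r add0r.
- by rewrite !inE wv.
Qed.

Lemma extend_vertex A t v : (0 < d)%N -> max_degree G d -> ~ A v ->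
  partial_isometric G A t -> general_position A t ->
  exists x, partial_isometric G (A `|` [set v]) (extend t v x) /\
    general_position (A `|` [set v]) (extend t v x).
Proof.
move=> d0 [deg _] Av Aiso Agp; have [k vk kd] := deg v.
have [N Nk NE] := finite_neighbours A vk.
have Nd := leq_trans Nk kd.
have /affine_independent_nth Nfree : affine_independent t N.
  by apply: Agp => [w /NE[]//|]; exact: leqW.
have [x [xN xs]] := generic_point_at_distances t
  (fun i => sqlen G [fset v; tnth (in_tuple N) i]%fset) d0 Nd Nfree.
exists x; split; last exact: extend_general_position.
have xw w : w != v -> edges G [fset v; w]%fset -> A w ->
    mform (x - t w) (x - t w) = sqlen G [fset v; w]%fset.
  move=> wv vw Aw; have /(tnthP (in_tuple N))[i ->] : w \in N by apply/NE.
  exact: xN.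
move=> a b ab Gab Aa Ab; rewrite /extend.
case: (eqVneq a v) ab Gab Aa => [->|av] ab Gab Aa;
  case: (eqVneq b v) ab Gab Ab => [->|bv] ab Gab Ab.
- by [].
- by apply: xw => //; case: Ab => //= bv'; rewrite bv' eqxx in bv.
- have -> : t a - x = - 1 *: (x - t a) by rewrite scaleN1r opprB.
  rewrite mformZl mformC mformZl !mulN1r opprK fsetUC; apply: xw => //.
    by rewrite fsetUC.
  by case: Aa => //= av'; rewrite av' eqxx in av.
- apply: Aiso => //; first by case: Aa => //= av'; rewrite av' eqxx in av.
  by case: Ab => //= bv'; rewrite bv' eqxx in bv.
Qed.

(** At stage n the map is correct on A and on the vertices of index below n, and
    later stages change it only at vertices of index at least n.  Isometry and general
    position only ever involve finitely many vertices, all of which are settled at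
    some stage. *)
Lemma extend_isometric A t : (0 < d)%N -> max_degree G d ->
  partial_isometric G A t -> general_position A t ->
  exists t', [/\ isometric G t', forall v, A v -> t' v = t v &
    general_position setT t'].
Proof.
move=> d0 hd Aiso Agp.
pose An n := A `|` [set v | (choice.pickle v < n)%N].
pose inv n t := partial_isometric G (An n) t /\ general_position (An n) t.
have step (nt : nat * (V -> minkowski R d)) : exists t', inv nt.1 nt.2 ->
    inv nt.1.+1 t' /\ forall v, An nt.1 v -> t' v = nt.2 v.
  case: nt => n u /=.
  have [[v [vn Av]]|none] :=
      pselect (exists v, choice.pickle v = n /\ ~ A v); last first.
    exists u => -[uiso ugp]; suff -> : inv n.+1 u = inv n u by [].
    rewrite /inv; suff -> : An n.+1 = An n by [].
    apply/seteqP; split=> w [Aw|/= wn]; try by left.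
      move: wn; rewrite ltnS leq_eqVlt => /orP[/eqP wn|]; last by right.
      by left; apply: contrapT => Aw; apply: none; exists w.
    by right; rewrite /= ltnW.
  have AnS : An n.+1 = An n `|` [set v].
    apply/seteqP; split=> w /=.
      case=> [Aw|/=]; first by left; left.
      rewrite ltnS leq_eqVlt => /orP[/eqP wn|]; last by left; right.
      by right; apply: (pcan_inj choice.pickleK); rewrite wn.
    by case=> [[Aw|/= wn]|->]; [left|right; rewrite /= ltnW|right; rewrite /= vn].
  have nAv : ~ An n v by case=> //=; rewrite vn ltnn.
  have [[uiso ugp]|nu] := pselect (inv n u); last by exists u.
  have [x xP] := extend_vertex d0 hd nAv uiso ugp.
  exists (extend u v x) => _; rewrite /inv AnS; split=> // w Aw.
  by rewrite /extend; case: (eqVneq w v) Aw nAv => // ->.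
have [next nextP] := choice step.
pose T := fix T n := if n is m.+1 then next (m, T m) else t.
have Tinv n : inv n (T n).
  elim: n => [|n IH]; last by have [] := nextP (n, T n) IH.
  rewrite /inv; suff -> : An 0%N = A by [].
  by apply/seteqP; split=> w; [case|left].
have TS n v : An n v -> T n.+1 v = T n v.
  by have [_] := nextP (n, T n) (Tinv n); apply.
have Tmono m n v : (m <= n)%N -> An m v -> T n v = T m v.
  move=> /subnK <-; elim: (n - m)%N => [//|l IH] mv; rewrite addSn TS ?IH //.
  by case: mv => [|/= vm]; [left|right; apply: leq_trans vm (leq_addl _ _)].
pose t' v := T (choice.pickle v).+1 v.
have t'A v : A v -> t' v = t v by move=> Av; apply: (Tmono 0%N) => //; left.
have t'E (s : {fset V}) : exists n, forall v, v \in s -> An n v /\ T n v = t' v.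
  exists (\max_(v <- s) (choice.pickle v).+1)%N => v vs.
  have vn : (choice.pickle v < \max_(v <- s) (choice.pickle v).+1)%N.
    exact: (leq_bigmax_seq (F := fun v => (choice.pickle v).+1)).
  by split; [right|apply: Tmono vn _; right => /=].
exists t'; split=> //.
  apply/isometricP => a b ab Gab _ _.
  have [n nE] := t'E [fset a; b]%fset.
  have [|Aa <-] := nE a; first by rewrite !inE eqxx.
  have [|Ab <-] := nE b; first by rewrite !inE eqxx orbT.
  by have [Tiso _] := Tinv n; apply: Tiso.
move=> s _ sd; have [n nE] := t'E s; have [_ Tgp] := Tinv n.
apply: (@eq_affine_independent (T n)) => [v /nE[]//|].
by apply: Tgp => // v /nE[].
Qed.

(** * Injectivity on the realization *)

(** The difference of the barycentric coordinates of two points with the same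
    image is an affine dependence on the union of their supports. *)
Lemma realization_inj A t n : has_dimension G n -> (2 * n + 1 <= d)%N ->
  general_position A t -> set_inj (realization G A) (affine_ext t).
Proof.
move=> [dimG _] nd Agp x y /set_mem[xG xA _ x1] /set_mem[yG yA _ y1] xy.
pose s := (finsupp x `|` finsupp y)%fset.
have sd : (#|` s| <= d.+1)%N.
  rewrite cardfsU; apply: leq_trans (leq_subr _ _) _.
  by apply: leq_trans (leq_add (dimG _ xG) (dimG _ yG)) _; lia.
have sumE (M : lmodType R) (f : V -> M) (z : {fsfun V -> R with 0}) :
    (finsupp z `<=` s)%fset ->
    \sum_(v <- s) z v *: f v = \sum_(v <- finsupp z) z v *: f v.
  move=> zs; rewrite (big_fset_incl _ zs) // => v _ /fsfun_dflt ->.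
  by rewrite scale0r.
have xs : (finsupp x `<=` s)%fset by exact: fsubsetUl.
have ys : (finsupp y `<=` s)%fset by exact: fsubsetUr.
have sum1E (z : {fsfun V -> R with 0}) : (finsupp z `<=` s)%fset ->
    \sum_(v <- s) z v = \sum_(v <- finsupp z) z v.
  move=> zs; have := @sumE R^o (fun=> 1) z zs.
  by under eq_bigr do rewrite /GRing.scale /= mulr1;
     under [RHS]eq_bigr do rewrite /GRing.scale /= mulr1.
have sA v : v \in s -> A v by rewrite inE => /orP[/xA|/yA].
have /(_ (fun v => x v - y v)) sfree := Agp s sA sd.
apply/fsfunP => v; have [vs|] := boolP (v \in s); last first.
  by rewrite inE negb_or => /andP[vx vy]; rewrite !fsfun_dflt.
apply/eqP; rewrite -subr_eq0; apply/eqP; apply: sfree => //.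
  by rewrite sumrB !sum1E // x1 y1 subrr.
under eq_bigr do rewrite scalerBl.
by rewrite sumrB !sumE //; apply/eqP; rewrite subr_eq0; apply/eqP.
Qed.

End Extension.

Theorem theorem2 (R : realType) (V : countType) (G : indefPolyhedron R V)
    (n d : nat) (hn : has_dimension G n) (hd : max_degree G d)
    (V' : set V) (tau' : V -> minkowski R d)
    (htau' : partial_isometric G V' tau')
    (gtau' : general_position V' tau') :
  (exists tau : V -> minkowski R d,
     [/\ isometric G tau,
         forall v, V' v -> tau v = tau' v &
         general_position setT tau]) /\
  ((2 * n + 1 <= d)%N ->
     set_inj (realization G V') (affine_ext tau') /\
     forall tau : V -> minkowski R d,
       isometric G tau ->
       (forall v, V' v -> tau v = tau' v) ->
       general_position setT tau ->
       isometric_embedding G tau).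
Proof.
split=> [|nd]; last first.
  split=> [|tau tiso _ tgp]; first exact: realization_inj hn nd gtau'.
  by split=> //; exact: realization_inj hn nd tgp.
(* For d = 0 there are no edges, and general position only concerns singletons. *)
have [d0|d0] := posnP d; last exact: extend_isometric.
exists tau'; split=> //.
  apply/isometricP => a b ab Gab _ _; exfalso.
  have [k ak] := hd.1 a; rewrite d0 leqn0 => /eqP k0; move: ak.
  rewrite k0 /has_degree II0 card_eq0 => /eqP E.
  suff : [set e | edges G e /\ a \in e] [fset a; b]%fset by rewrite E.
  by split=> //; rewrite !inE eqxx.
move=> s _ sd c c0 _ v vs.
have s1 : (#|` s| <= 1)%N by move: sd; rewrite d0.
have sE : s = [fset v]%fset.
  by apply/eqP; rewrite eq_sym eqEfcard fsub1set vs cardfs1.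
by move: c0; rewrite sE big_seq_fset1.
Qed.
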